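(* Let $X$ be a first countable, locally compact, paracompact, Hausdorff space and let $f:X\to X$ be a topologically Anosov homeomorphism. Then there exist neighborhoods $B$ and $D$ of $\Delta_X$ and a continuous map $t:D\to X$ such that (1) $W^s_B(x)\cap W^u_B(y)$ contains at most one point for any $x,y\in X$; (2) $W^s_B(x)\cap W^u_B(y)=\{t(x,y)\}$ whenever $(x,y)\in D$; (3) for every $x\in X$, $W^s_B(x)\cap D[x]=\{y\in X:(x,y)\in D \text{ and } y=t(x,y)\}$; (4) for every $x\in X$, $W^u_B(x)\cap D[x]=\{y\in X:(x,y)\in D,\ (y,x)\in D \text{ and } y=t(y,x)\}$.
   Context: Write $\Delta_X=\{(x,x):x\in X\}\subset X\times X$ and $F=f\times f:X\times X\to X\times X$. A neighborhood of $\Delta_X$ is a subset of $X\times X$ containing an open set that contains $\Delta_X$. For $U\subset X\times X$ and $x\in X$, $U[x]=\{y\in X:(x,y)\in U\}$. A homeomorphism $f$ is (topologically) expansive if there is a closed neighborhood $N$ of $\Delta_X$ such that for any distinct $x,y\in X$ there exists $n\in\mathbb Z$ with $F^n(x,y)\notin N$. For a neighborhood $D$ of $\Delta_X$, a $D$-pseudo-orbit is a bi-infinite sequence $\{x_i\}_{i\in\mathbb Z}$ in $X$ with $(f(x_{i-1}),x_i)\in D$ for all $i$. For a neighborhood $E$ of $\Delta_X$, it is $E$-traced by $y\in X$ if $(f^i(y),x_i)\in E$ for all $i\in\mathbb Z$. $f$ has the (topological) shadowing property if for every neighborhood $E$ of $\Delta_X$ there is a neighborhood $D$ of $\Delta_X$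 such that every $D$-pseudo-orbit is $E$-traced by some point of $X$. $f$ is topologically Anosov if it is expansive and has the shadowing property. For a neighborhood $B$ of $\Delta_X$ and $x\in X$, the local stable and unstable sets are $W^s_B(x)=\{y\in X:F^i(x,y)\in B \text{ for all } i\ge 0\}$ and $W^u_B(x)=\{y\in X:F^i(x,y)\in B\text{ for all } i\le 0\}$. *)

(* Defs.v *)
From mathcomp Require Import all_boot all_order all_algebra.
From mathcomp Require Import all_classical topology.

Set Implicit Arguments.
Unset Strict Implicit.
Unset Printing Implicit Defensive.

Import Order.TTheory GRing.Theory Num.Theory.

Local Open Scope classical_set_scope.
Local Open Scope ring_scope.

Section spaces.
Variable X : topologicalType.

Definition first_countable := forall x : X,
  exists2 B : set (set X), countable B &
    B `<=` nbhs x /\ forall A, nbhs x A -> exists2 U, B U & U `<=` A.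

Definition open_cover (C : set (set X)) :=
  C `<=` open /\ \bigcup_(U in C) U = [set: X].

Definition refines (V C : set (set X)) :=
  forall A, V A -> exists2 U, C U & A `<=` U.

Definition locally_finite (V : set (set X)) := forall x : X,
  exists2 W, nbhs x W & finite_set [set A | V A /\ A `&` W !=set0].

(* The Hausdorff axiom is not part of this definition. *)
Definition paracompact := forall C, open_cover C ->
  exists V, [/\ open_cover V, refines V C & locally_finite V].

Definition diag_nbhd (N : set (X * X)) :=
  exists2 O, open O & diagonal `<=` O /\ O `<=` N.

(* U[x]; this is the library's [xsection] without the boolean membership. *)
Definition slice (U : set (X * X)) (x : X) : set X := [set y | U (x, y)].

End spaces.

(* A homeomorphism carries its inverse as data, so that its negative iterates
   are defined without choice. *)
Record homeo (X : topologicalType) := Homeo {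
  homeo_fun :> X -> X;
  homeo_inv : X -> X;
  homeo_funK : cancel homeo_fun homeo_inv;
  homeo_invK : cancel homeo_inv homeo_fun;
  homeo_fun_continuous : continuous homeo_fun;
  homeo_inv_continuous : continuous homeo_inv }.

Definition iterz (X : topologicalType) (f : homeo X) (n : int) : X -> X :=
  match n with
  | Posz k => iter k f
  | Negz k => iter k.+1 (homeo_inv f)
  end.

Section square.
Variable X : topologicalType.

Definition sq (g : X -> X) (p : X * X) : X * X := (g p.1, g p.2).

Lemma sqK (g h : X -> X) : cancel g h -> cancel (sq g) (sq h).
Proof. by move=> gK [x y]; rewrite /sq /= !gK. Qed.

Lemma sq_continuous (g : X -> X) : continuous g -> continuous (sq g).
Proof.
move=> cg p; apply: cvg_pair => /=.
- by apply: (cvg_comp fst g _ (cg p.1)); exact: cvg_fst.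
- by apply: (cvg_comp snd g _ (cg p.2)); exact: cvg_snd.
Qed.

Definition sq_homeo (f : homeo X) : homeo (X * X)%type :=
  Homeo (sqK (@homeo_funK _ f)) (sqK (@homeo_invK _ f))
    (sq_continuous (@homeo_fun_continuous _ f))
    (sq_continuous (@homeo_inv_continuous _ f)).

End square.

Section dynamics.
Variables (X : topologicalType) (f : homeo X).

Definition expansive := exists N : set (X * X),
  [/\ closed N, diag_nbhd N &
      forall x y : X, x <> y ->
        exists n : int, ~ N (iterz (sq_homeo f) n (x, y))].

Definition pseudo_orbit (D : set (X * X)) (x : int -> X) :=
  forall i : int, D (f (x (i - 1)), x i).

Definition traced (E : set (X * X)) (x : int -> X) (y : X) :=
  forall i : int, E (iterz f i y, x i).

Definition shadowing := forall E : set (X * X), diag_nbhd E ->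
  exists2 D, diag_nbhd D &
    forall x, pseudo_orbit D x -> exists y, traced E x y.

Definition topologically_Anosov := expansive /\ shadowing.

Definition Ws (B : set (X * X)) (x : X) : set X :=
  [set y | forall i : int, 0 <= i -> B (iterz (sq_homeo f) i (x, y))].

Definition Wu (B : set (X * X)) (x : X) : set X :=
  [set y | forall i : int, i <= 0 -> B (iterz (sq_homeo f) i (x, y))].

End dynamics.

(* Main.v *)
Require Import Defs.
From mathcomp Require Import all_boot all_order all_algebra.
From mathcomp Require Import all_classical unstable topology.

Import Order.TTheory GRing.Theory Num.Theory.

Local Open Scope classical_set_scope.

(** The point [t (x, y)] shadows the pseudo-orbit that follows the forward orbit
    of [x] and the backward orbit of [y].  It exists when [x] and [y] are close,
    and it is unique by expansiveness.  Paracompactness makes the neighbourhoods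
    of the diagonal a uniformity, which provides the needed halves of
    neighbourhoods and allows [B] to be closed with locally precompact slices.
    Then the graph of [t] is closed and [t] locally takes values in a compact
    set, so [t] is continuous. *)

(** * Neighbourhoods of the diagonal *)

Lemma locally_compact_regular (X : topologicalType) :
  locally_compact [set: X] -> hausdorff_space X -> regular_space X.
Proof.
move=> lcX hX x; have [K xK [cK _]] := lcX x I.
by apply: compact_regular cK _ => //; move: xK; rewrite withinET.
Qed.

Lemma diag_nbhdP {X : topologicalType} (N : set (X * X)) :
  diag_nbhd N <-> forall x : X, nbhs (x, x) N.
Proof.
split=> [[O oO [dO ON]] x|nN].
  by apply: (filterS ON); apply: open_nbhs_nbhs; split=> //; exact: dO.
exists N°; first exact: open_interior.
split; last exact: interior_subset.
by move=> [x y] xy; rewrite (xy : x = y); exact: nN.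
Qed.

Lemma diag_nbhd_refl {X : topologicalType} {N : set (X * X)} :
  diag_nbhd N -> forall x, N (x, x).
Proof. by move=> /diag_nbhdP nN x; exact: nbhs_singleton. Qed.

Lemma diag_nbhdS {X : topologicalType} (M N : set (X * X)) :
  M `<=` N -> diag_nbhd M -> diag_nbhd N.
Proof.
by move=> MN /diag_nbhdP nM; apply/diag_nbhdP => x; apply: filterS (nM x).
Qed.

Lemma diag_nbhdI {X : topologicalType} (M N : set (X * X)) :
  diag_nbhd M -> diag_nbhd N -> diag_nbhd (M `&` N).
Proof.
by move=> /diag_nbhdP nM /diag_nbhdP nN; apply/diag_nbhdP => x; exact: filterI.
Qed.

Lemma swap_continuous (X Y : topologicalType) :
  continuous (@swap X Y).
Proof. by move=> p; apply: cvg_pair; [exact: cvg_snd|exact: cvg_fst]. Qed.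

Lemma diag_nbhd_swap {X : topologicalType} (N : set (X * X)) :
  diag_nbhd N -> diag_nbhd (swap @^-1` N).
Proof.
move=> /diag_nbhdP nN; apply/diag_nbhdP => x.
exact: (@swap_continuous X X (x, x) _ (nN x)).
Qed.

(** * Consequences of paracompactness *)

(* Kelley's argument: the intersection of the [V S] below is a neighbourhood of
   the diagonal because only finitely many [S] matter near each point. *)
Lemma paracompact_even {X : topologicalType} (C : set (set X)) :
  regular_space X -> paracompact X -> open_cover C ->
  exists2 V, diag_nbhd V & forall x, exists2 U, C U & slice V x `<=` U.
Proof.
move=> rX pX [Copen Ccov].
(* Regularity leaves room: even the closures of the refining sets will fit inside members of [C]. *)
pose C' := [set W : set X | open W /\ exists2 U, C U & closure W `<=` U].
have C'cov : open_cover C'.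
  split=> [W []//|]; rewrite -subTset => x _.
  have [U CU Ux] : (\bigcup_(U in C) U) x by rewrite Ccov.
  have [W nW WU] := rX x U (open_nbhs_nbhs (conj (Copen _ CU) Ux)).
  exists W°; last exact: nW.
  split; first exact: open_interior.
  exists U => //; apply: subset_trans WU.
  by apply: closure_subset; exact: interior_subset.
have [A [[Aopen Acov] ref lf]] := pX _ C'cov.
have [u uP] : {u : set X -> set X &
    forall S, A S -> C (u S) /\ closure S `<=` u S}.
  apply: (@choice _ _ (fun S W => A S -> C W /\ closure S `<=` W)) => S.
  have [AS|nAS] := pselect (A S); last by exists set0.
  have [W [_ [U CU WU]] SW] := ref _ AS.
  by exists U => _; split=> //; apply: subset_trans (closure_subset SW) WU.
(* For [S] in [A], [V S] is a neighbourhood of the diagonal because [closure S] lies in the open set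
   [u S]; its slice at a point of [S] lies in [u S]. *)
pose V S := (u S `*` u S) `|` (~` closure S `*` ~` closure S).
exists (\bigcap_(S in A) V S); last first.
  move=> x; have [S AS Sx] : (\bigcup_(S in A) S) x by rewrite Acov.
  exists (u S); first by case: (uP _ AS).
  move=> y /(_ _ AS) [[]//|[/= nSx _]].
  by case: nSx; exact: subset_closure.
apply/diag_nbhdP => x.
have [W nW fW] := lf x.
have VS S : A S -> nbhs (x, x) (V S).
  move=> AS; have [CuS SuS] := uP _ AS.
  have [Sx|nSx] := pselect (closure S x).
    have nu : nbhs x (u S).
      by apply: open_nbhs_nbhs; split; [exact: Copen|exact: SuS].
    by exists (u S, u S) => // p ?; left.
  have nc : nbhs x (~` closure S).
    by apply: open_nbhs_nbhs; split=> //; exact/closed_openC/closed_closure.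
  by exists (~` closure S, ~` closure S) => // p ?; right.
have [F FE] := finite_fsetP.1 fW.
have nF : nbhs (x, x) (\bigcap_(S in [set S | A S /\ S `&` W !=set0]) V S).
  rewrite FE; apply: filter_bigI => S; move=> SF.
  by apply: VS; move: SF; move/(congr1 (@^~ S)): FE => /= <- [].
have nWW : nbhs (x, x) (W° `*` W°).
  by exists (W°, W°) => //; split; exact: nbhs_interior.
apply: filterS (filterI nF nWW) => -[a b] [Fab [/= Wa Wb]] S AS.
(* If [S] misses [W], its closure misses the interior of [W], so [V S] contains the square of that
   interior. *)
have [SW|SW] := pselect (S `&` W !=set0).
  exact: Fab.
have nS c : W° c -> ~ closure S c by move=> Wc /(_ _ Wc).
by right; split; exact: nS.
Qed.

(** Cover [X] by open sets whose squares lie in [N]. If [x] and [z] are in the slice of [V] at [y],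
    one such set contains both; symmetrizing [V] turns a chain from [x] through [y] to [z] into this
    situation. *)
Lemma diag_nbhd_half {X : topologicalType} {N : set (X * X)} :
  regular_space X -> paracompact X -> diag_nbhd N ->
  exists M, [/\ diag_nbhd M, forall x y, M (x, y) -> M (y, x) &
    forall x y z, M (x, y) -> M (y, z) -> N (x, z)].
Proof.
move=> rX pX /diag_nbhdP nN.
have [|V nV VP] := @paracompact_even X
    [set U | open U /\ U `*` U `<=` N] rX pX.
  split=> [U []//|]; rewrite -subTset => x _.
  have [[P Q] /= [nP nQ] PQN] := nN x.
  exists (P `&` Q)°; last exact: filterI.
  split; first exact: open_interior.
  move=> [a b] [/= /interior_subset[Pa _] /interior_subset[_ Qb]].
  exact: PQN.
exists (V `&` swap @^-1` V); split.
- by apply: diag_nbhdI => //; exact: diag_nbhd_swap.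
- by move=> x y [].
- move=> x y z [_ Vyx] [Vyz _]; have [U [_ UN] VU] := VP y.
  by apply: (UN (x, z)); split; exact: VU.
Qed.

(** Taking the closure costs two extra links: a point [(x, y)] of [closure V3] gives a chain [x],
    [a], [b], [y] of [V3]-links. Padded by a trivial link at [y], it is absorbed by two halvings, so
    [closure V3] lies in [V1], a half of [N]. *)
Lemma diag_nbhd_closed_half {X : topologicalType} {N : set (X * X)} :
  regular_space X -> paracompact X -> diag_nbhd N ->
  exists M, [/\ closed M, diag_nbhd M, forall x y, M (x, y) -> M (y, x) &
    forall x y z, M (x, y) -> M (y, z) -> N (x, z)].
Proof.
move=> rX pX nN.
have [V1 [n1 s1 h1]] := diag_nbhd_half rX pX nN.
have [V2 [n2 s2 h2]] := diag_nbhd_half rX pX n1.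
have [V3 [n3 s3 h3]] := diag_nbhd_half rX pX n2.
have cl31 x y : closure V3 (x, y) -> V1 (x, y).
  move=> cV; have /diag_nbhdP n3' := n3.
  have [[P1 P2] /= [P1x P2x] P3] := n3' x.
  have [[Q1 Q2] /= [Q1y Q2y] Q3] := n3' y.
  have nPQ : nbhs (x, y) (P2 `*` Q1) by exists (P2, Q1).
  have [[a b] [Vab [/= Pa Qb]]] := cV _ nPQ.
  have Vxa : V3 (x, a) by apply: P3; split=> //; exact: nbhs_singleton.
  have Vby : V3 (b, y) by apply: Q3; split=> //; exact: nbhs_singleton.
  apply: (h2 x b y); first exact: (h3 x a b).
  by apply: (h3 b y y) => //; exact: diag_nbhd_refl.
exists (closure V3 `&` swap @^-1` closure V3); split.
- apply: closedI; first exact: closed_closure.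
  apply: preimage_closed; last exact: closed_closure.
  by move=> p _; exact: swap_continuous.
- have nc : diag_nbhd (closure V3).
    by apply: diag_nbhdS n3; exact: subset_closure.
  by apply: diag_nbhdI => //; exact: diag_nbhd_swap.
- by move=> x y [].
- by move=> x y z [Vxy _] [Vyz _]; apply: (h1 x y z); exact: cl31.
Qed.

(** Applies the even-cover lemma to open sets contained in compact ones; this will confine the
    values of [t]. *)
Lemma diag_nbhd_compact_slices {X : topologicalType} :
  regular_space X -> paracompact X -> locally_compact [set: X] ->
  exists2 V : set (X * X), diag_nbhd V &
    forall x, exists2 K, compact K & slice V x `<=` K.
Proof.
move=> rX pX lcX.
have [|V nV VP] := @paracompact_even X
    [set U | open U /\ exists2 K, compact K & U `<=` K] rX pX.
  split=> [U []//|]; rewrite -subTset => x _.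
  have [K xK [cK _]] := lcX x I; rewrite withinET in xK.
  exists K°; last exact: xK.
  split; first exact: open_interior.
  by exists K => //; exact: interior_subset.
exists V => // x; have [U [_ [K cK UK]] VU] := VP x.
by exists K => //; exact: subset_trans VU UK.
Qed.

(** * Continuity from a closed graph *)

Lemma closed_graph_continuous_within (T Y : topologicalType) (D : set T)
    (G : set (T * Y)) (t : T -> Y) :
  closed G -> (forall p, D p -> G (p, t p)) ->
  (forall p y, D p -> G (p, y) -> y = t p) ->
  (forall p, D p -> exists2 K, compact K & \forall q \near p, D q -> K (t q)) ->
  {within D, continuous t}.
Proof.
move=> cG tG Gt tK; apply/subspace_continuousP => p Dp O nO.
have [K cK nK] := tK _ Dp.
(* Each [y] in [K] other than [t p] has a neighbourhood that [t q] avoids for [q] near [p];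
   compactness of [K] makes one neighbourhood of [p] work for all [y]. *)
have tO : \forall q \near within D (nbhs p), K `<=` (fun y => t q = y -> O y).
  apply: ((compact_near_coveringP K).1 cK) => y Ky.
  have [->|ytp] := pselect (y = t p).
    exists (O, setT); first by split=> //; exact: filterT.
    by move=> [z q] [/= Oz _].
  have nG : nbhs (p, y) (~` G).
    apply: open_nbhs_nbhs; split; first exact: closed_openC.
    by move=> /(Gt _ _ Dp).
  have [[P Q] /= [nP nQ] PQG] := nG.
  exists (Q, [set q | D q /\ P q]).
    by split=> //; apply: filterS nP => q.
  move=> [z q] [/= Qz [Dq Pq]] tqz.
  by case: (PQG (q, z)) => //; rewrite -tqz; exact: tG.
have wK : \forall q \near within D (nbhs p), K (t q) by exact: nK.
by apply: filterS2 wK tO => q Kq; exact.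
Qed.

(** * Iterates and local stable and unstable sets *)

Lemma iterz_sq {X : topologicalType} (f : homeo X) n (p : X * X) :
  iterz (sq_homeo f) n p = (iterz f n p.1, iterz f n p.2).
Proof.
case: n => k; rewrite /iterz; last move: k.+1 => {}k.
all: by elim: k => [|k IH]; [case: p|rewrite !iterS IH].
Qed.

Lemma iterzS {X : topologicalType} (f : homeo X) n (x : X) :
  f (iterz f (n - 1)%R x) = iterz f n x.
Proof.
case: n => [[|k]|k].
- by rewrite sub0r /= homeo_invK.
- have -> : (Posz k.+1 - 1 = Posz k)%R by rewrite -addn1 PoszD addrK.
  by [].
- have -> : (Negz k - 1 = Negz k.+1)%R.
    by rewrite !NegzE -[in RHS]addn1 PoszD opprD.
  by rewrite /iterz [in LHS]iterS homeo_invK.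
Qed.

Lemma iterz_continuous {X : topologicalType} (f : homeo X) n :
  continuous (iterz f n).
Proof.
have it g k : continuous g -> continuous (@iter X k g).
  move=> cg; elim: k => [|k IH] x; first exact: cvg_id.
  by apply: (cvg_comp (iter k g) g (IH x)); exact: cg.
case: n => k; apply: it; first exact: homeo_fun_continuous.
exact: homeo_inv_continuous.
Qed.

Lemma closed_Ws {X : topologicalType} (f : homeo X) (B : set (X * X)) :
  closed B -> closed [set p | Ws f B p.1 p.2].
Proof.
move=> cB.
have -> : [set p | Ws f B p.1 p.2] =
    \bigcap_(i in [set i : int | (0 <= i)%R]) (iterz (sq_homeo f) i @^-1` B).
  by apply/seteqP; split=> -[x y].
apply: closed_bigI => i _.
by apply: preimage_closed => // p _; exact: iterz_continuous.
Qed.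

Lemma closed_Wu {X : topologicalType} (f : homeo X) (B : set (X * X)) :
  closed B -> closed [set p | Wu f B p.1 p.2].
Proof.
move=> cB.
have -> : [set p | Wu f B p.1 p.2] =
    \bigcap_(i in [set i : int | (i <= 0)%R]) (iterz (sq_homeo f) i @^-1` B).
  by apply/seteqP; split=> -[x y].
apply: closed_bigI => i _.
by apply: preimage_closed => // p _; exact: iterz_continuous.
Qed.

(** Two common points are both [B]-close to the orbit of [x] at times [n >= 0] and to that of [y] at
    negative times, hence [N]-close to each other at all times. *)
Lemma Ws_Wu_subset1 {X : topologicalType} (f : homeo X) (B N : set (X * X)) :
  (forall x y, B (x, y) -> B (y, x)) ->
  (forall x y z, B (x, y) -> B (y, z) -> N (x, z)) ->
  (forall x y : X, x <> y -> exists n, ~ N (iterz (sq_homeo f) n (x, y))) ->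
  forall x y, is_subset1 (Ws f B x `&` Wu f B y).
Proof.
move=> Bsym BN Nexp x y z w [zs zu] [ws wu].
apply: contrapT => /Nexp[n]; apply; rewrite iterz_sq /=.
have [n0|n0] := leP 0%R n.
- have := ws n n0; have := zs n n0; rewrite !iterz_sq /= => /Bsym.
  exact: BN.
- have := wu n (ltW n0); have := zu n (ltW n0); rewrite !iterz_sq /= => /Bsym.
  exact: BN.
Qed.

Lemma shadowing_Ws_Wu {X : topologicalType} (f : homeo X)
    (B E D : set (X * X)) :
  diag_nbhd E -> (forall x y, E (x, y) -> E (y, x)) ->
  (forall x y z, E (x, y) -> E (y, z) -> B (x, z)) ->
  diag_nbhd D ->
  (forall x, pseudo_orbit f D x -> exists y, traced f E x y) ->
  forall x y, E (x, y) -> D (y, x) -> Ws f B x `&` Wu f B y !=set0.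
Proof.
move=> nE Esym EB nD shad x y Exy Dyx.
have EsubB a b : E (a, b) -> B (a, b).
  by move=> ?; apply: (EB a b b) => //; exact: diag_nbhd_refl.
(* The only jump is at time 0, from [y] to [x], hence the hypothesis [D (y, x)]. *)
pose o i := if (0 <= i)%R then iterz f i x else iterz f i y.
have [i|z zE] := shad o.
  rewrite /o; have [i0|i0|->] := ltgtP i 0%R.
  - rewrite leNgt (_ : (i - 1 < 0)%R) ?(le_lt_trans _ i0) ?lerBlDr ?lerDl//=.
    by rewrite iterzS; exact: diag_nbhd_refl.
  - by rewrite subr_ge0 -gtz0_ge1 i0 iterzS; exact: diag_nbhd_refl.
  - by rewrite iterzS.
exists z; split=> i i0; rewrite iterz_sq /=.
  by apply/EsubB/Esym; have := zE i; rewrite /o i0.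
(* At time 0 the point [z] traces [x], not [y]; [E (x, y)] supplies the missing link. *)
have [iN|iN|i0'] := ltgtP i 0%R.
- by apply/EsubB/Esym; have := zE i; rewrite /o leNgt iN.
- by move: iN; rewrite ltNge i0.
- rewrite i0'; apply: (EB y x z); first exact: Esym.
  by apply: Esym; exact: (zE 0%R).
Qed.

(** * Construction of [B], [D] and [t] *)

Theorem proposition20 (X : topologicalType) (f : homeo X) :
  first_countable X -> locally_compact [set: X] -> paracompact X ->
  hausdorff_space X -> topologically_Anosov f ->
  exists (B D : set (X * X)) (t : X * X -> X),
    diag_nbhd B /\ diag_nbhd D /\ {within D, continuous t} /\
    (forall x y : X, is_subset1 (Ws f B x `&` Wu f B y)) /\
    (forall x y : X, D (x, y) -> Ws f B x `&` Wu f B y = [set t (x, y)]) /\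
    (forall x : X,
       Ws f B x `&` slice D x = [set y | D (x, y) /\ y = t (x, y)]) /\
    (forall x : X,
       Wu f B x `&` slice D x =
         [set y | [/\ D (x, y), D (y, x) & y = t (y, x)]]).
Proof.
move=> _ lcX pX hX [[N [_ nN Nexp]] shad].
have rX := locally_compact_regular _ lcX hX.
have [V nV VK] := diag_nbhd_compact_slices rX pX lcX.
(* [N] serves uniqueness, [V] compactness, and closedness of [B] makes the graph of [t] closed. *)
have [B [cB nB Bsym BNV]] := diag_nbhd_closed_half rX pX (diag_nbhdI _ _ nN nV).
have [E [nE Esym EB]] := diag_nbhd_half rX pX nB.
have [D' nD' D'shad] := shad _ nE.
(* Shadowing uses [D' (y, x)]; taking [D'] in both orders makes [D] symmetric, which yields
   [D (y, x)] in the last conclusion. *)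
pose D := E `&` (D' `&` swap @^-1` D').
have Dsym x y : D (x, y) -> D (y, x).
  by move=> [Exy [D'xy D'yx]]; split=> //; exact: Esym.
have sub1 : forall x y, is_subset1 (Ws f B x `&` Wu f B y).
  by apply: Ws_Wu_subset1 Nexp => // x y z Bxy /(BNV _ _ _ Bxy)[].
have [t tP] : {t : X * X -> X &
    forall p, D p -> (Ws f B p.1 `&` Wu f B p.2) (t p)}.
  apply: (@choice _ _ (fun p z => D p -> (Ws f B p.1 `&` Wu f B p.2) z)).
  move=> [x y].
  have [[Exy [_ D'yx]]|nD] := pselect (D (x, y)); last by exists x.
  have [z zP] := shadowing_Ws_Wu f _ _ _ nE Esym EB nD' D'shad x y Exy D'yx.
  by exists z.
have tE x y z : D (x, y) -> Ws f B x z -> Wu f B y z -> z = t (x, y).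
  by move=> Dxy zs zu; apply: (sub1 x y) => //; exact: (tP (x, y)).
have Brefl i x y : x = y -> B (iterz (sq_homeo f) i (x, y)).
  by move=> ->; rewrite iterz_sq; exact: diag_nbhd_refl.
exists B, D, t; split=> //; split; last split; last split=> //; last split;
  last split.
- by apply/diag_nbhdI/diag_nbhdI => //; exact: diag_nbhd_swap.
- apply: (@closed_graph_continuous_within _ _ D
    [set q : (X * X) * X | Ws f B q.1.1 q.2 /\ Wu f B q.1.2 q.2]).
  + apply: closedI.
      apply: (@preimage_closed _ _ (fun q : (X * X) * X => (q.1.1, q.2))
        [set p | Ws f B p.1 p.2]); last exact: closed_Ws.
      move=> q _; apply: cvg_pair; last exact: cvg_snd.
      by apply: (cvg_comp fst fst); exact: cvg_fst.
    apply: (@preimage_closed _ _ (fun q : (X * X) * X => (q.1.2, q.2))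
      [set p | Wu f B p.1 p.2]); last exact: closed_Wu.
    move=> q _; apply: cvg_pair; last exact: cvg_snd.
    by apply: (cvg_comp fst snd); [exact: cvg_fst|exact: cvg_snd].
  + exact: tP.
  + by move=> [x y] z Dxy [zs zu]; exact: tE.
  (* For [x'] near [x], both [(x, x')] and, by time 0, [(x', t (x', y'))] lie in [B], so
     [t (x', y')] lies in the slice of [V] at [x]. *)
  + move=> [x y] Dxy; have [K cK VxK] := VK x.
    exists K => //.
    have /diag_nbhdP nB' := nB.
    have [[P Q] /= [Px Qx] PQB] := nB' x.
    exists (Q, setT); first by split=> //; exact: filterT.
    move=> [x' y'] [/= Qx' _] Dx'y'; apply: VxK.
    have [] // := BNV x x' (t (x', y')).
      by apply: PQB; split=> //; exact: nbhs_singleton.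
    by have [/(_ 0%R (lexx _))] := tP _ Dx'y'.
- move=> x y Dxy; apply/seteqP; split=> [z [zs zu]|_ ->]; first exact: tE.
  exact: (tP (x, y)).
(* Always [y] lies in [Wu f B y], so uniqueness identifies it with [t (x, y)]; the next case uses
   [Ws f B y] and [t (y, x)] likewise. *)
- move=> x; apply/seteqP; split=> y.
    by move=> [ys Dxy]; split=> //; apply: tE => // i _; exact: Brefl.
  by move=> [Dxy yt]; split=> //; rewrite yt; have [] := tP _ Dxy.
- move=> x; apply/seteqP; split=> y.
    move=> [yu Dxy]; split=> //; first exact: Dsym.
    by apply: tE => //; [exact: Dsym|move=> i _; exact: Brefl].
  by move=> [Dxy Dyx yt]; split=> //; rewrite yt; have [] := tP _ Dyx.
Qed.
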